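(* Let $c\in(0,1)$, $b=\frac{1+c}{2}$ and $a\in\mathbb{R}$. Let $J$ be a solution of $$\frac{c}{2}J''(t)=\bigl[-b+c\,\Theta(t)\bigr]\,t\,J'(t)+J(t)-\Theta(t)+\frac{c^2}{4}J'(t)^2,\qquad J(-\infty)=1,\quad J(+\infty)=0,$$ and suppose that $J$ lies on the physical (no-node) branch, i.e. the function $f(t)=\Theta(t)+\frac{c}{2}J''(t)$ satisfies $0\le f(t)\le 1$ for all $t$. Let $p_1$ be a nonnegative solution of $$\frac{c}{2}p_1''(t)=\bigl(a-c\,\Theta(t)\bigr)p_1(t)+\bigl(b-c\,\Theta(t)\bigr)\,t\,p_1'(t)-\frac{c^2}{2}\bigl(p_1'(t)J'(t)+p_1(t)J''(t)\bigr)$$ such that $p_1(t)/(-t)^{\theta}$ tends to a positive finite constant as $t\to-\infty$ and $p_1(t)/t^{-\alpha}$ tends to a positive finite constant as $t\to+\infty$, where $\theta=\frac{c-a}{b-c}$ and $\alpha=\frac{a}{b}$ are both positive. Suppose that the marginal-stability condition $$\frac12=\frac{\int_{-\infty}^{\infty}p_1(t)\,f(t)^2\,(1-f(t))\,dt}{\int_{-\infty}^{\infty}p_1(t)\,f'(t)^2\,dt}$$ holds. Then $$a+\frac{c}{2}=\frac12,$$ equivalently $a+b=1$.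
   Context: $\Theta:\mathbb{R}\setminus\{0\}\to\{0,1\}$ denotes the indicator of the negative half-line: $\Theta(t)=1$ for $t<0$ and $\Theta(t)=0$ for $t>0$. A solution $J$ of the nonlinear equation is a real function in $C^1(\mathbb{R})$, twice continuously differentiable on each open half-line $(-\infty,0)$ and $(0,\infty)$ (hence $C^\infty$ there), satisfying the equation for all $t\neq0$ and the stated limits at $\pm\infty$. A solution $p_1$ of the linear equation is a real function in $C^1(\mathbb{R})$, twice continuously differentiable on each open half-line, satisfying the equation for all $t\ne 0$. $f$ and $f'$ are considered for $t\neq 0$ (the single point $t=0$ is irrelevant for the integrals). The triple $(a,b,c)$ satisfying these conditions consists of the critical exponents of the full replica-symmetry-breaking jamming solution: the eigenvalue condition on $p_1$ fixes $a=a(c)$, and the marginal-stability condition fixes $c$. *)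

(* Defs.v *)
From HB Require Import structures.
From mathcomp Require Import all_boot all_order all_algebra.
From mathcomp Require Import all_classical all_reals all_analysis.

Set Implicit Arguments.
Unset Strict Implicit.
Unset Printing Implicit Defensive.

Import Order.TTheory GRing.Theory Num.Theory.
Import numFieldNormedType.Exports.

Local Open Scope classical_set_scope.
Local Open Scope ring_scope.

(* The value at t = 0 is a convention (the problem only defines it for t != 0);
   every use below is either at t != 0 or under a Lebesgue integral. *)
Definition Theta (R : realType) (t : R) : R := if t < 0 then 1 else 0.

(* C^1 on R, and C^2 on each of ]-oo, 0[ and ]0, +oo[. These half-lines are
   open, so C^2 there is pointwise derivability of u' and pointwise
   continuity of u'' at every t != 0. *)
Definition C1_C2off0 (R : realType) (u : R -> R) : Prop :=
  [/\ forall t, derivable u t 1,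
      continuous (derive1 u),
      forall t : R, t != 0 -> derivable (derive1 u) t 1
    & forall t : R, t != 0 -> {for t, continuous (derive1 (derive1 u))}].

Definition J_solution (R : realType) (b c : R) (J : R -> R) : Prop :=
  [/\ C1_C2off0 J,
      forall t : R, t != 0 ->
        c / 2 * derive1 (derive1 J) t =
          (- b + c * Theta t) * t * derive1 J t + J t - Theta t
          + c ^+ 2 / 4 * (derive1 J t) ^+ 2,
      J t @[t --> -oo] --> (1 : R)
    & J t @[t --> +oo] --> (0 : R)].

Definition f_of (R : realType) (c : R) (J : R -> R) (t : R) : R :=
  Theta t + c / 2 * derive1 (derive1 J) t.

Definition p1_solution (R : realType) (a b c : R) (J p1 : R -> R) : Prop :=
  C1_C2off0 p1 /\
  forall t : R, t != 0 ->
    c / 2 * derive1 (derive1 p1) t =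
      (a - c * Theta t) * p1 t + (b - c * Theta t) * t * derive1 p1 t
      - c ^+ 2 / 2 * (derive1 p1 t * derive1 J t + p1 t * derive1 (derive1 J) t).

Definition theta_exp (R : realType) (a b c : R) : R := (c - a) / (b - c).

Definition alpha_exp (R : realType) (a b : R) : R := a / b.

(* [Rintegral] is the real-valued Lebesgue integral, equal to 0 when the
   extended-real integral is infinite, and x / 0 = 0. Both integrands are
   nonnegative for t != 0 when p1 >= 0 and 0 <= f <= 1, so in that case the
   equation forces both integrals to be finite and nonzero. *)
Definition marginally_stable (R : realType) (p1 f : R -> R) : Prop :=
  1 / 2 =
    (\int[lebesgue_measure]_t (p1 t * f t ^+ 2 * (1 - f t)))
    / (\int[lebesgue_measure]_t (p1 t * (derive1 f t) ^+ 2)).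

(* Main.v *)
(* Write f for the continuous extension of Theta + (c/2) J'' and
   G(t) = - b t + c t Theta(t) + (c^2/2) J'(t). Differentiating the equation of
   J twice, the jumps at 0 cancel and f solves (c/2) f'' - G f' = - c f (1 - f),
   while the equation of p1 reads (c/2) p1'' + (G p1)' = (a - b) p1. These two
   operators are adjoint, and g = f (1 - f) satisfies
   (c/2) g'' - G g' = - c g + c (2 f^2 (1 - f) - f'^2), so that integrating by
   parts against p1 gives
     (a - b + c) int p1 g = c (2 int p1 f^2 (1 - f) - int p1 f'^2) = 0
   by marginal stability. Hence a = b - c, i.e. a + b = 2 b - c = 1. The boundary
   terms vanish because f, 1 - f and J' decay faster than any power where they
   tend to 0, whereas p1 grows at most polynomially. The integrals are truncated
   to [-n, n], so the integrability of p1 g is never needed: it suffices that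
   p1 f^2 (1 - f) <= p1 g. *)
Require Import Defs.
From HB Require Import structures.
From mathcomp Require Import all_boot all_order all_algebra.
From mathcomp Require Import all_classical all_reals all_analysis.
From mathcomp Require Import ring lra.

Set Implicit Arguments.
Unset Strict Implicit.
Unset Printing Implicit Defensive.

Import Order.TTheory GRing.Theory Num.Theory.
Import numFieldNormedType.Exports.

Local Open Scope classical_set_scope.
Local Open Scope ring_scope.

(** * Pointwise rules of differentiation *)

Lemma is_derive_cst_pt (R : realType) (k x : R) :
  is_derive x 1 (fun=> k) 0.
Proof. exact: is_derive_cst. Qed.

Lemma is_derive_id_pt (R : realType) (x : R) : is_derive x 1 (fun y => y) 1.
Proof. exact: is_derive_id. Qed.

Lemma is_deriveN_pt (R : realType) (u : R -> R) (x du : R) :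
  is_derive x 1 u du -> is_derive x 1 (fun y => - u y) (- du).
Proof. by move=> ?; exact: is_deriveN. Qed.

Lemma is_deriveD_pt (R : realType) (u v : R -> R) (x du dv : R) :
  is_derive x 1 u du -> is_derive x 1 v dv ->
  is_derive x 1 (fun y => u y + v y) (du + dv).
Proof. by move=> ? ?; exact: is_deriveD. Qed.

Lemma is_deriveM_pt (R : realType) (u v : R -> R) (x du dv : R) :
  is_derive x 1 u du -> is_derive x 1 v dv ->
  is_derive x 1 (fun y => u y * v y) (du * v x + u x * dv).
Proof.
move=> hu hv; have := is_deriveM hu hv; rewrite /GRing.scale /= => h.
suff -> : du * v x + u x * dv = u x * dv + v x * du by exact: h.
ring.
Qed.

Lemma is_deriveX_pt (R : realType) (u : R -> R) (n : nat) (x du : R) :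
  is_derive x 1 u du ->
  is_derive x 1 (fun y => u y ^+ n) (n%:R * u x ^+ n.-1 * du).
Proof.
move=> hu; have := @is_deriveX _ _ u n x 1 du hu.
rewrite /GRing.scale /= => h; suff -> : (fun y => u y ^+ n) = u ^+ n by [].
exact/esym/exprfctE.
Qed.

Lemma is_derive_opp_pt (R : realType) (u : R -> R) (x du : R) :
  is_derive (- x) 1 u du -> is_derive x 1 (fun y => u (- y)) (- du).
Proof.
by move=> hu; rewrite -mulrN1; exact: is_derive1_comp.
Qed.

(** Recursion on the body of a lambda; the rules above are restated for [fun y => ...] so that they
    match such bodies directly. *)
Ltac derive_pt :=
  first [ assumption
        | apply: is_derive_cst_pt
        | apply: is_derive_id_pt
        | apply: is_deriveN_pt; derive_pt
        | apply: is_deriveD_pt; derive_pt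
        | apply: is_deriveM_pt; derive_pt
        | apply: is_deriveX_pt; derive_pt ].

(** * Mean value estimates on the positive half-line *)

Lemma MVT_gt0 (R : realType) (u du : R -> R) :
  (forall x : R, 0 < x -> is_derive x 1 u (du x)) ->
  forall x y : R, 0 < x -> x < y ->
  exists2 z : R, x < z < y & u y - u x = du z * (y - x).
Proof.
move=> hu x y x0 xy.
have [||z] := @MVT _ u du x y xy.
- move=> z; rewrite in_itv /= => /andP[xz _].
  by apply: hu; exact: lt_trans xz.
- apply: derivable_within_continuous => z; rewrite in_itv /= => /andP[xz _].
  by have [] := hu z (lt_le_trans x0 xz).
by rewrite in_itv /=; exists z.
Qed.

Lemma nincr_gt (R : realType) (u du : R -> R) (N : R) :
  0 <= N ->
  (forall x : R, 0 < x -> is_derive x 1 u (du x)) ->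
  (forall x : R, N < x -> du x <= 0) ->
  forall x y : R, N < x -> x <= y -> u y <= u x.
Proof.
move=> N0 hu du0 x y Nx; rewrite le_eqVlt => /predU1P[->//|xy].
have [z /andP[xz _]] := MVT_gt0 hu (le_lt_trans N0 Nx) xy.
have := du0 z (lt_trans Nx xz) => dz e.
by rewrite -subr_le0 e mulr_le0_ge0// subr_ge0 ltW.
Qed.

Lemma cvgy_dist (R : realType) (u : R -> R) (l e : R) :
  u x @[x --> +oo] --> l -> 0 < e ->
  exists2 N : R, 0 <= N & forall x : R, N < x -> `|u x - l| < e.
Proof.
move=> ul e0; have /cvgrPdist_lt/(_ e e0)[N [_ HN]] := ul.
exists (Num.max 0 N); first by rewrite le_max lexx.
by move=> x; rewrite gt_max => /andP[_ /HN]; rewrite distrC.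
Qed.

(** Were [h x] positive, monotonicity would make [phi] grow by at least [h x] over every later unit
    interval, whereas eventually any two values of [phi] differ by less than [h x]. *)
Lemma slope_le0 (R : realType) (phi h : R -> R) (l : R) :
  (forall x : R, 0 < x -> is_derive x 1 phi (h x)) ->
  (forall x y : R, 0 < x -> x <= y -> h x <= h y) ->
  phi x @[x --> +oo] --> l ->
  forall x : R, 0 < x -> h x <= 0.
Proof.
move=> hphi hh hl x x0; rewrite leNgt; apply/negP => hx.
have [N N0 HN] := cvgy_dist hl (divr_gt0 hx (ltr0n _ 2)).
have mx : 0 < Num.max x (N + 1) by rewrite lt_max x0.
have xm : x <= Num.max x (N + 1) by rewrite le_max lexx.
have Nm : N < Num.max x (N + 1) by rewrite lt_max ltrDl ltr01 orbT.
set y := Num.max _ _ in mx xm Nm.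
have yy1 : y < y + 1 by lra.
have [z /andP[yz _]] := MVT_gt0 hphi mx yy1.
have Ny1 : N < y + 1 by lra.
have := HN _ Nm; have := HN _ Ny1; have := hh _ _ x0 (ltW (le_lt_trans xm yz)).
rewrite !ltr_norml => h1 /andP[h2 h3] /andP[h4 h5] h6; lra.
Qed.

(** The increment of [phi] over [[x - 1, x]] equals [h z] for some [z < x], hence is at most [h x],
    and it tends to 0. *)
Lemma slope_gt (R : realType) (phi h : R -> R) (l : R) :
  (forall x : R, 0 < x -> is_derive x 1 phi (h x)) ->
  (forall x y : R, 0 < x -> x <= y -> h x <= h y) ->
  phi x @[x --> +oo] --> l ->
  forall e : R, 0 < e -> exists2 N : R, 0 <= N & forall x : R, N < x -> - e < h x.
Proof.
move=> hphi hh hl e e0.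
have [N N0 HN] := cvgy_dist hl (divr_gt0 e0 (ltr0n _ 2)).
exists (N + 1) => [|x Nx]; first lra.
have x1 : 0 < x - 1 by lra.
have xx : x - 1 < x by lra.
have [z /andP[yz zx]] := MVT_gt0 hphi x1 xx.
have N1 : N < x - 1 by lra.
have N2 : N < x by lra.
have := HN _ N1; have := HN _ N2; have := hh _ _ (lt_trans x1 yz) (ltW zx).
rewrite !ltr_norml => h1 /andP[h2 h3] /andP[h4 h5] h6; lra.
Qed.

(** * Decay on a half-line for the system [phi' = h], [h' = (2 / c) u] *)

(** Once [x >= 1] and [k x >= n], the loss [k x] outweighs the gain [n / x], so [x ^+ n * u x] is
    nonincreasing and stays below an earlier value. *)
Lemma superpoly_decay (R : realType) (u du : R -> R) (k N : R) :
  0 < k -> 0 <= N ->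
  (forall x : R, 0 < x -> is_derive x 1 u (du x)) ->
  (forall x : R, 0 < x -> 0 <= u x) ->
  (forall x : R, N < x -> du x <= - k * x * u x) ->
  forall n, exists2 N', N <= N' &
    exists C, forall x : R, N' < x -> x ^+ n * u x <= C.
Proof.
move=> k0 N0 hu u0 duk n.
set M := Num.max (Num.max N 1) (n%:R / k).
have [NM M1 nkM] : [/\ N <= M, 1 <= M & n%:R / k <= M].
  by rewrite /M !le_max !lexx !orbT.
have dw (x : R) : 0 < x -> is_derive x 1 (fun y => y ^+ n * u y)
    (n%:R * x ^+ n.-1 * 1 * u x + x ^+ n * du x).
  by move=> x0; have := hu x x0 => ?; derive_pt.
have dwle (x : R) : M < x -> n%:R * x ^+ n.-1 * 1 * u x + x ^+ n * du x <= 0.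
  move=> Mx; have x1 : 1 < x by apply: le_lt_trans Mx.
  have x0 : 0 < x by lra.
  have xn0 m : 0 <= x ^+ m by rewrite exprn_ge0// ltW.
  have nkx : n%:R <= k * x.
    by rewrite mulrC -ler_pdivrMr//; apply: le_trans (ltW Mx).
  have dux : x ^+ n * du x <= x ^+ n * (- k * x * u x).
    by rewrite ler_wpM2l// duk// (le_lt_trans NM).
  have nx : x ^+ n.-1 * n%:R <= x ^+ n * (k * x).
    by rewrite ler_pM// ler_weXn2l ?leq_pred// ltW.
  have : (x ^+ n.-1 * n%:R) * u x <= (x ^+ n * (k * x)) * u x.
    by rewrite ler_wpM2r// u0.
  lra.
exists (M + 1); first lra.
exists ((M + 1) ^+ n * u (M + 1)) => x Mx.
have M0 : 0 <= M by lra.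
by apply: (nincr_gt M0 dw dwle); lra.
Qed.

(** [h + D u] is nonincreasing and eventually above any negative number, since [D u >= 0]; a
    negative value at [x] would persist. *)
Lemma slope_dominated (R : realType) (h dh u du : R -> R) (N D : R) :
  0 <= N ->
  (forall x : R, 0 < x -> is_derive x 1 h (dh x)) ->
  (forall x : R, 0 < x -> is_derive x 1 u (du x)) ->
  (forall e : R, 0 < e -> exists2 M : R, 0 <= M & forall x : R, M < x -> - e < h x) ->
  (forall x : R, 0 < x -> 0 <= D * u x) ->
  (forall x : R, N < x -> dh x + D * du x <= 0) ->
  forall x : R, N < x -> - h x <= D * u x.
Proof.
move=> N0 hh hu hlim Du0 le0 x Nx; rewrite leNgt; apply/negP => neg.
have e0 : 0 < - (h x + D * u x) by lra.
have [M M0 HM] := hlim _ e0.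
have dw (z : R) : 0 < z -> is_derive z 1 (fun y => h y + D * u y)
    (dh z + (0 * u z + D * du z)).
  by move=> z0; have := hu z z0; have := hh z z0 => ? ?; derive_pt.
have dwle (z : R) : N < z -> dh z + (0 * u z + D * du z) <= 0.
  by move=> /le0; rewrite mul0r add0r.
have xM : x <= Num.max x (M + 1) by rewrite le_max lexx.
have MM : M < Num.max x (M + 1) by rewrite lt_max ltrDl ltr01 orbT.
have := nincr_gt N0 dw dwle Nx xM; have := HM _ MM.
have := Du0 _ (le_lt_trans M0 MM); lra.
Qed.

(* Convexity of [phi] gives [h <= 0] and [h --> 0], so the equation of [u]
   yields [u' <= - (be / c) * x * u] for [x] large, a Gaussian decay. *)
Lemma halfline_decay (R : realType) (c be ka l : R) (phi h u : R -> R) :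
  0 < c -> 0 < be < 1 ->
  (forall x : R, 0 < x -> is_derive x 1 phi (h x)) ->
  (forall x : R, 0 < x -> is_derive x 1 h (2 / c * u x)) ->
  (forall x : R, 0 < x -> is_derive x 1 u
     ((1 - be) * h x + 2 / c * (- be * x + ka * h x) * u x)) ->
  (forall x : R, 0 < x -> 0 <= u x) ->
  phi x @[x --> +oo] --> l ->
  exists2 N : R, 1 <= N & exists2 D : R, 0 <= D &
    (forall x : R, N < x -> [/\ - 1 <= h x, h x <= 0 & - h x <= D * u x]) /\
    forall n, exists2 N' : R, N <= N' &
      exists C : R, forall x : R, N' < x -> x ^+ n * u x <= C.
Proof.
move=> c0 /andP[be0 be1] hphi hh hu u0 philim.
have c'0 : 0 < 2 / c by rewrite divr_gt0.
have h_nd (x y : R) : 0 < x -> x <= y -> h x <= h y.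
  move=> x0; rewrite le_eqVlt => /predU1P[->//|xy].
  have [z /andP[xz _] e] := MVT_gt0 hh x0 xy.
  rewrite -subr_ge0 e mulr_ge0 ?subr_ge0 ?(ltW xy)//.
  by rewrite mulr_ge0 ?(ltW c'0)// u0// (lt_trans x0).
have h_le0 := slope_le0 hphi h_nd philim.
have h_gt := slope_gt hphi h_nd philim.
have [N1 N10 HN1] := h_gt 1 ltr01.
(* Beyond this threshold [|h| <= 1] and [|ka| <= be x / 2], so half of the damping [- be x] survives
   the term [ka h]. *)
set N := Num.max (Num.max N1 1) (2 * `|ka| / be).
have [N1N N_ge1 kaN] : [/\ N1 <= N, 1 <= N & 2 * `|ka| / be <= N].
  by rewrite /N !le_max !lexx !orbT.
have N0 : 0 <= N by lra.
pose k := be / c; have k0 : 0 < k by rewrite divr_gt0.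
have du_le (x : R) : N < x ->
    (1 - be) * h x + 2 / c * (- be * x + ka * h x) * u x <= - k * x * u x.
  move=> Nx; have x0 : 0 < x by lra.
  have h0 := h_le0 x x0.
  have h1 : - 1 < h x by apply: HN1; apply: le_lt_trans Nx.
  have kax : 2 * `|ka| <= be * x.
    by rewrite [leRHS]mulrC -ler_pdivrMr// (le_trans kaN)// ltW.
  have kah : ka * h x <= `|ka|.
    apply: le_trans (ler_norm _) _; rewrite normrM ler_piMr// ler_norml; lra.
  have bh : (1 - be) * h x <= 0 by rewrite mulr_ge0_le0//; lra.
  have : (2 / c * u x) * (- be * x + ka * h x) <= (2 / c * u x) * (- (be * x) / 2).
    by rewrite ler_wpM2l ?mulr_ge0 ?(ltW c'0) ?u0//; lra.
  have -> : 2 / c * u x * (- (be * x) / 2) = - k * x * u x.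
    by rewrite /k; field; lra.
  lra.
(* Chosen so that [D k = 2 / c]: then [D u' <= - (2 / c) x u], which absorbs [h' = (2 / c) u]
   because [x >= 1]. *)
pose D := 2 / (c * k); have D0 : 0 < D by rewrite divr_gt0// mulr_gt0.
exists N => //; exists D; first exact: ltW.
split; last exact: superpoly_decay k0 N0 hu u0 du_le.
move=> x Nx; split.
- by apply/ltW/HN1; apply: le_lt_trans Nx.
- by apply: h_le0; lra.
apply: (slope_dominated N0 hh hu h_gt) Nx.
  by move=> y y0; rewrite mulr_ge0 ?(ltW D0)// u0.
move=> y Ny; have y0 : 0 < y by lra.
have : D * ((1 - be) * h y + 2 / c * (- be * y + ka * h y) * u y)
    <= D * (- k * y * u y) by rewrite ler_wpM2l ?(ltW D0)// du_le.
have -> : D * (- k * y * u y) = - (2 / c) * u y * y.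
  by rewrite /D; field; lra.
have : 2 / c * u y * 1 <= 2 / c * u y * y.
  by rewrite ler_wpM2l// ?mulr_ge0 ?(ltW c'0) ?u0//; lra.
lra.
Qed.

(** The mean value theorem from [N + 1] costs one power of [x]. It bounds the flux by the growth of
    [p1] alone, so that [p1'] never has to be estimated. *)
Lemma primitive_poly_growth (R : realType) (q K : R -> R) (mu M N : R) (n : nat) :
  1 <= N -> 0 <= M ->
  (forall x : R, 0 < x -> is_derive x 1 K (mu * q x)) ->
  (forall x : R, N < x -> `|q x| <= M * x ^+ n) ->
  exists2 L, 0 <= L & forall x : R, N + 1 < x -> `|K x| <= L * x ^+ n.+1.
Proof.
move=> N1 M0 hK hq; have N0 : 0 < N + 1 by lra.
exists (`|K (N + 1)| + `|mu| * M) => [|x Nx]; first by rewrite addr_ge0 ?mulr_ge0.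
have x0 : 0 < x by lra.
have [z /andP[Nz zx] e] := MVT_gt0 hK N0 Nx.
have {e}-> : K x = K (N + 1) + mu * q z * (x - (N + 1)) by rewrite -e; ring.
apply: le_trans (ler_normD _ _) _; rewrite mulrDl lerD//.
  have x1 : 1 <= x ^+ n.+1 by apply: exprn_ege1; lra.
  by rewrite ler_peMr.
have Nz' : N < z by lra.
have qz : `|q z| <= M * x ^+ n.
  apply: le_trans (hq z Nz') _; rewrite ler_wpM2l//.
  by apply: lerXn2r; rewrite ?nnegrE; lra.
have xN : `|x - (N + 1)| <= x by rewrite ler_norml; lra.
rewrite !normrM -!mulrA ler_wpM2l// exprS (mulrC x) mulrA.
by rewrite ler_pM.
Qed.

(** Common form of the boundary term at both ends: [u] is [f] or the reflected [1 - f], [be] is [b]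
    or [b - c], [ka] is plus or minus [c ^+ 2 / 2], and [K] is the flux up to sign. Every summand
    carries a factor [u] or [h], and [|h| <= D u], so the decay of [u] beats the polynomial growth
    of [q] and [K]. *)
Lemma flux_cvg0 (R : realType) (c be ka l mu M N : R) (n : nat)
    (phi h u q K : R -> R) :
  0 < c -> 0 < be < 1 ->
  (forall x : R, 0 < x -> is_derive x 1 phi (h x)) ->
  (forall x : R, 0 < x -> is_derive x 1 h (2 / c * u x)) ->
  (forall x : R, 0 < x -> is_derive x 1 u
     ((1 - be) * h x + 2 / c * (- be * x + ka * h x) * u x)) ->
  (forall x : R, 0 < x -> 0 <= u x <= 1) ->
  phi x @[x --> +oo] --> l ->
  (forall x : R, 0 < x -> is_derive x 1 K (mu * q x)) ->
  0 <= M -> (forall x : R, N < x -> `|q x| <= M * x ^+ n) ->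
  c / 2 * q x * (1 - 2 * u x)
    * ((1 - be) * h x + 2 / c * (- be * x + ka * h x) * u x)
    - K x * (u x * (1 - u x)) @[x --> +oo] --> 0.
Proof.
move=> c0 be01 hphi hh hu u01 philim hK M0 hq.
have /andP[be0 be1] := be01.
have u0 (x : R) : 0 < x -> 0 <= u x by move=> /u01/andP[].
have c'0 : 0 < 2 / c by rewrite divr_gt0.
have [N1 N1_ge1 [D D0 [hN1 uN1]]] := halfline_decay c0 be01 hphi hh hu u0 philim.
(* The whole expression will be at most [A x^(n+1) u]; the further power in [n.+2] leaves the bound
   [A C / x]. *)
have [N2 N12 [C HC]] := uN1 n.+2.
set N3 := Num.max 1 N.
have [N31 N3N] : 1 <= N3 /\ N <= N3 by rewrite /N3 !le_max !lexx orbT.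
have hq3 (x : R) : N3 < x -> `|q x| <= M * x ^+ n.
  by move=> Nx; apply: hq; apply: le_lt_trans Nx.
have [L L0 HL] := primitive_poly_growth N31 M0 hK hq3.
(* Constant in [|u'| <= E x u], obtained from [- h <= D u], [|h| <= 1] and [x > 1]. *)
pose E := (1 - be) * D + 2 / c * (be + `|ka|).
have E0 : 0 <= E.
  have be1' : 0 <= 1 - be by lra.
  by rewrite addr_ge0// mulr_ge0// ?addr_ge0// ltW.
pose A := c / 2 * M * E + L.
have A0 : 0 <= A by rewrite addr_ge0// !mulr_ge0// ltW.
have bound (x : R) : N2 < x -> N3 + 1 < x ->
    `|c / 2 * q x * (1 - 2 * u x)
      * ((1 - be) * h x + 2 / c * (- be * x + ka * h x) * u x)
      - K x * (u x * (1 - u x))| <= A * C / x.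
  move=> N2x N3x; have N1x := le_lt_trans N12 N2x.
  have x1 : 1 < x by lra.
  have x0 : 0 < x by lra.
  have /andP[ux0 ux1] := u01 x x0.
  have [h1 h0 hD] := hN1 x N1x.
  have qx : `|q x| <= M * x ^+ n by apply: hq3; lra.
  have Kx := HL x N3x.
  have Cx := HC x N2x.
  have xn0 m : 0 <= x ^+ m by rewrite exprn_ge0// ltW.
  have duE : `|(1 - be) * h x + 2 / c * (- be * x + ka * h x) * u x|
      <= E * x * u x.
    have t1 : `|(1 - be) * h x| <= (1 - be) * D * (x * u x).
      rewrite normrM ger0_norm; last lra.
      rewrite -mulrA ler_wpM2l//; first lra.
      rewrite ler0_norm// (le_trans hD)// ler_wpM2l// ler_peMl//; lra.
    have t2 : `|2 / c * (- be * x + ka * h x) * u x|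
        <= 2 / c * (be + `|ka|) * (x * u x).
      rewrite 2!normrM (ger0_norm ux0) [leRHS]mulrA ler_wpM2r//.
      rewrite -[leRHS]mulrA (ger0_norm (ltW c'0)) ler_wpM2l ?(ltW c'0)//.
      apply: le_trans (ler_normD _ _) _; rewrite !normrM normrN mulrDl.
      rewrite (ger0_norm (ltW be0)) (ger0_norm (ltW x0)) lerD// ler_wpM2l//.
      rewrite ler0_norm//; lra.
    apply: le_trans (ler_normD _ _) _; rewrite /E; lra.
  have s1 : `|c / 2 * q x * (1 - 2 * u x)
      * ((1 - be) * h x + 2 / c * (- be * x + ka * h x) * u x)|
      <= c / 2 * M * E * (x ^+ n.+1 * u x).
    rewrite 2!normrM.
    have -> : c / 2 * M * E * (x ^+ n.+1 * u x)
      = (c / 2 * (M * x ^+ n)) * 1 * (E * x * u x) by rewrite exprS; ring.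
    have c2 : 0 <= c / 2 by lra.
    have cq : `|c / 2 * q x| <= c / 2 * (M * x ^+ n).
      by rewrite normrM (ger0_norm c2) ler_wpM2l.
    have u2 : `|1 - 2 * u x| <= 1 by rewrite ler_norml; lra.
    by rewrite ler_pM// ler_pM.
  have s2 : `|K x * (u x * (1 - u x))| <= L * (x ^+ n.+1 * u x).
    rewrite normrM mulrA ler_pM// ger0_norm ?mulr_ge0//; last lra.
    by rewrite ler_piMr//; lra.
  apply: le_trans (ler_normB _ _) _.
  apply: le_trans (_ : A * (x ^+ n.+1 * u x) <= _); first by rewrite /A; lra.
  rewrite -mulrA ler_wpM2l// ler_pdivlMr// mulrC mulrA -exprS.
  exact: Cx.
apply/cvgrPdist_lt => e e0.
(* [C] comes without a sign, hence the absolute value in the threshold. *)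
have AC0 : 0 <= `|A * C| by [].
exists (Num.max (Num.max N2 (N3 + 1)) (`|A * C| / e)); split; first exact: num_real.
move=> x; rewrite !gt_max => /andP[/andP[N2x N3x] ex].
have x0 : 0 < x by lra.
rewrite sub0r normrN; apply: le_lt_trans (bound x N2x N3x) _.
rewrite ltr_pdivrMr//; apply: le_lt_trans (ler_norm _) _.
by rewrite [ltRHS]mulrC -ltr_pdivrMr.
Qed.

(** * Continuous versions of [f] and [f'], and the differential identities off 0 *)

(* [t * Theta t], written so that its continuity at [0] is visible. *)
Definition negpart_id (R : realType) (t : R) : R := Num.min t 0.

(** The function G of the overview. In its derivative the jump of [c * Theta] cancels that of
    [c ^+ 2 / 2 * J'']. *)
Definition drift (R : realType) (b c : R) (J : R -> R) (t : R) : R :=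
  - b * t + c * negpart_id t + c ^+ 2 / 2 * derive1 J t.

(* The equation of [J] makes this equal to [f_of c J] off [0]; unlike [f_of],
   it is also continuous at [0]. *)
Definition profile (R : realType) (b c : R) (J : R -> R) (t : R) : R :=
  (- b * t + c * negpart_id t) * derive1 J t + J t
  + c ^+ 2 / 4 * derive1 J t ^+ 2.

(* [f'] off [0]; the jumps of its terms at [0] cancel. *)
Definition profile_slope (R : realType) (b c : R) (J : R -> R) (t : R) : R :=
  (1 - b) * derive1 J t + 2 / c * drift b c J t * profile b c J t
  - 2 / c * (c - b) * negpart_id t.

(** Puts the equation of [p1] in divergence form: the derivative of this flux is [(a - b) * p1]. *)
Definition flux (R : realType) (b c : R) (J p : R -> R) (t : R) : R :=
  c / 2 * derive1 p t + drift b c J t * p t.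

(* The boundary term of the integration by parts of [p] against
   the adjoint operator applied to [f (1 - f)]. *)
Definition boundary (R : realType) (b c : R) (J p : R -> R) (t : R) : R :=
  c / 2 * p t * (1 - 2 * profile b c J t) * profile_slope b c J t
  - flux b c J p t * (profile b c J t * (1 - profile b c J t)).

Lemma Theta_neg (R : realType) (t : R) : t < 0 -> Theta t = 1.
Proof. by rewrite /Theta => ->. Qed.

Lemma Theta_pos (R : realType) (t : R) : 0 < t -> Theta t = 0.
Proof. by rewrite /Theta ltNge => /negbTE t0; case: ltP => // /ltW; rewrite t0. Qed.

Lemma negpart_idE (R : realType) (t : R) : negpart_id t = Theta t * t.
Proof. by rewrite /negpart_id /Theta; case: ltP => _; rewrite ?mul1r ?mul0r. Qed.

Lemma Theta01 (R : realType) (t : R) : Theta t = 0 \/ Theta t = 1.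
Proof. by rewrite /Theta; case: ifP; [right|left]. Qed.

Lemma near_Theta (R : realType) (t : R) : t != 0 ->
  \forall x \near t, Theta x = Theta t.
Proof.
rewrite neq_lt => /orP[t0|t0]; near=> x.
  rewrite !Theta_neg//; near: x; exact: lt_nbhsl.
rewrite !Theta_pos//; near: x; exact: lt_nbhsr.
Unshelve. all: by end_near. Qed.

Lemma is_derive_negpart_id (R : realType) (t : R) : t != 0 ->
  is_derive t 1 (@negpart_id R) (Theta t).
Proof.
move=> t0; have hd : is_derive t 1 (fun x => Theta t * x) (0 * t + Theta t * 1).
  by derive_pt.
rewrite mul0r add0r mulr1 in hd.
apply: near_eq_is_derive hd.
by apply: filterS (near_Theta t0) => x xt; rewrite negpart_idE xt.
Qed.

Lemma continuous_negpart_id (R : realType) : continuous (@negpart_id R).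
Proof.
move=> t; apply: continuous_min; [exact: cvg_id|exact: cvg_cst].
Qed.

Lemma is_derive_derive1 (R : realType) (u : R -> R) (t : R) :
  derivable u t 1 -> is_derive t 1 u (derive1 u t).
Proof. by move=> /derivableP; rewrite derive1E. Qed.

Lemma is_derive_J (R : realType) (b c : R) (J : R -> R) (t : R) :
  J_solution b c J -> is_derive t 1 J (derive1 J t).
Proof. by case=> -[dJ _ _ _] _ _ _; exact: is_derive_derive1. Qed.

Lemma is_derive_slopeJ (R : realType) (b c : R) (J : R -> R) (t : R) :
  c != 0 -> J_solution b c J -> t != 0 ->
  is_derive t 1 (derive1 J) (2 / c * (profile b c J t - Theta t)).
Proof.
move=> c0 [[_ _ ddJ _] eqJ _ _] t0.
suff <- : derive1 (derive1 J) t = 2 / c * (profile b c J t - Theta t).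
  by apply: is_derive_derive1; exact: ddJ.
have -> : profile b c J t - Theta t = c / 2 * derive1 (derive1 J) t.
  by rewrite eqJ// /profile negpart_idE; ring.
by field.
Qed.

Lemma is_derive_drift (R : realType) (b c : R) (J : R -> R) (t : R) :
  c != 0 -> J_solution b c J -> t != 0 ->
  is_derive t 1 (drift b c J) (- b + c * profile b c J t).
Proof.
move=> c0 hJ t0.
have := is_derive_slopeJ c0 hJ t0; have := is_derive_negpart_id t0 => ? ?.
rewrite /drift; apply: is_derive_eq; rewrite /GRing.scale /=; by field.
Qed.

Lemma is_derive_profile (R : realType) (b c : R) (J : R -> R) (t : R) :
  c != 0 -> J_solution b c J -> t != 0 ->
  is_derive t 1 (profile b c J) (profile_slope b c J t).
Proof.
move=> c0 hJ t0.
have := is_derive_slopeJ c0 hJ t0; have := is_derive_J t hJ.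
have := is_derive_negpart_id t0 => ? ? ?.
rewrite {1}/profile; apply: is_derive_eq.
rewrite /profile_slope /drift !negpart_idE /GRing.scale /=.
(* The identity rests on [Theta ^+ 2 = Theta], which [field] cannot see; hence the two cases. *)
by have [->|->] := Theta01 t; field.
Qed.

(** The relation [2 b = 1 + c] acts twice: it turns the coefficient [1 - 2 b] of [profile] into
    [- c], and it cancels the coefficient [2 b - 1 - c] of [Theta]. *)
Lemma is_derive_profile_slope (R : realType) (b c : R) (J : R -> R) (t : R) :
  0 < c -> b = (1 + c) / 2 -> J_solution b c J -> t != 0 ->
  is_derive t 1 (profile_slope b c J)
    (2 / c * (drift b c J t * profile_slope b c J t
              - c * (profile b c J t * (1 - profile b c J t)))).
Proof.
move=> c_gt0 hb hJ t0; have c0 : c != 0 by rewrite gt_eqF.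
have := is_derive_slopeJ c0 hJ t0; have := is_derive_profile c0 hJ t0.
have := is_derive_drift c0 hJ t0; have := is_derive_negpart_id t0 => ? ? ? ?.
rewrite {1}/profile_slope; apply: is_derive_eq.
by rewrite hb /GRing.scale /=; field.
Qed.

Lemma is_derive_flux (R : realType) (a b c : R) (J p : R -> R) (t : R) :
  0 < c -> J_solution b c J -> p1_solution a b c J p -> t != 0 ->
  is_derive t 1 (flux b c J p) ((a - b) * p t).
Proof.
move=> c_gt0 hJ [[dp _ ddp _] eqp] t0; have c0 : c != 0 by rewrite gt_eqF.
have := is_derive_drift c0 hJ t0; have := is_derive_derive1 (dp t).
have := is_derive_derive1 (ddp t t0) => ? ? ?.
rewrite /flux; apply: is_derive_eq.
have J2 : derive1 (derive1 J) t = 2 / c * (profile b c J t - Theta t).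
  by have := is_derive_slopeJ c0 hJ t0 => /@derive_val; rewrite derive1E.
(* Exposes the left-hand side of the equation of [p1], so that it can be rewritten. *)
have p2 : derive1 (derive1 p) t = 2 / c * (c / 2 * derive1 (derive1 p) t).
  by field.
by rewrite p2 eqp// J2 /drift negpart_idE /GRing.scale /=; field.
Qed.

(** Lagrange's identity for the two adjoint operators, with [g = f (1 - f)]: the terms
    [(c / 2) p' g'] cancel, leaving [p ((c / 2) g'' - G g') - (a - b) p g]. *)
Lemma is_derive_boundary (R : realType) (a b c : R) (J p : R -> R) (t : R) :
  0 < c -> b = (1 + c) / 2 -> J_solution b c J -> p1_solution a b c J p ->
  t != 0 ->
  is_derive t 1 (boundary b c J p)
    (c * (2 * (p t * profile b c J t ^+ 2 * (1 - profile b c J t))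
          - p t * profile_slope b c J t ^+ 2)
     - (a - b + c) * (p t * (profile b c J t * (1 - profile b c J t)))).
Proof.
move=> c_gt0 hb hJ hp t0; have c0 : c != 0 by rewrite gt_eqF.
have := is_derive_profile c0 hJ t0; have := is_derive_flux c_gt0 hJ hp t0.
have := is_derive_profile_slope c_gt0 hb hJ t0.
case: (hp) => -[dp _ _ _] _; have := is_derive_derive1 (dp t) => ? ? ? ?.
rewrite {1}/boundary; apply: is_derive_eq.
by rewrite /flux /GRing.scale /=; field.
Qed.

(** * Continuity across 0 *)

Lemma continuous_drift (R : realType) (b c : R) (J : R -> R) :
  J_solution b c J -> continuous (drift b c J).
Proof.
case=> -[_ cJ _ _] _ _ _ t.
apply: cvgD; last by apply: cvgMr; exact: cJ.
by apply: cvgD; apply: cvgMr; [exact: cvg_id|exact: continuous_negpart_id].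
Qed.

Lemma continuous_profile (R : realType) (b c : R) (J : R -> R) :
  J_solution b c J -> continuous (profile b c J).
Proof.
case=> -[dJ cJ _ _] _ _ _ t.
apply: cvgD; last by apply: cvgMr; apply: (cvgM (cJ t) (cJ t)).
apply: cvgD; last first.
  by apply: differentiable_continuous; apply/derivable1_diffP.
apply: cvgM; last exact: cJ.
by apply: cvgD; apply: cvgMr; [exact: cvg_id|exact: continuous_negpart_id].
Qed.

Lemma continuous_profile_slope (R : realType) (b c : R) (J : R -> R) :
  J_solution b c J -> continuous (profile_slope b c J).
Proof.
move=> hJ t; case: (hJ) => -[_ cJ _ _] _ _ _.
apply: cvgB; last by apply: cvgMr; exact: continuous_negpart_id.
apply: cvgD; first by apply: cvgMr; exact: cJ.
apply: cvgM; last exact: continuous_profile.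
by apply: cvgMr; exact: continuous_drift.
Qed.

Lemma continuous_p1 (R : realType) (a b c : R) (J p : R -> R) :
  p1_solution a b c J p -> continuous p.
Proof.
by case=> -[dp _ _ _] _ t; apply: differentiable_continuous; apply/derivable1_diffP.
Qed.

Lemma continuous_boundary (R : realType) (a b c : R) (J p : R -> R) :
  J_solution b c J -> p1_solution a b c J p -> continuous (boundary b c J p).
Proof.
move=> hJ hp t; case: (hp) => -[_ cp _ _] _.
have cF := continuous_profile hJ.
apply: cvgB; apply: cvgM.
- apply: cvgM; first by apply: cvgMr; exact: continuous_p1 hp _.
  by apply: cvgB; [exact: cvg_cst|apply: cvgMr; exact: cF].
- exact: continuous_profile_slope.
- apply: cvgD; first by apply: cvgMr; exact: cp.
  by apply: cvgM; [exact: continuous_drift|exact: continuous_p1 hp _].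
- by apply: cvgM; [exact: cF|apply: cvgB; [exact: cvg_cst|exact: cF]].
Qed.

(** * Integrals over symmetric intervals and over the line *)

Lemma continuous_integrable_itv (R : realType) (v : R -> R) (x y : R) :
  continuous v ->
  (@lebesgue_measure R).-integrable `[x, y] (EFin \o v).
Proof.
move=> cv; apply: continuous_compact_integrable; first exact: segment_compact.
exact: continuous_subspaceT.
Qed.

(* The primitive is allowed to fail to be derivable at [0]. *)
Lemma FTC2_off0 (R : realType) (B v : R -> R) (N : R) :
  0 < N -> continuous B -> continuous v ->
  (forall t : R, t != 0 -> is_derive t 1 B (v t)) ->
  \int[lebesgue_measure]_(t in `[- N, N]) v t = B N - B (- N).
Proof.
move=> N0 cB cv dB.
have FTC (x y : R) : x < y -> (forall t, x < t < y -> t != 0) ->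
    \int[lebesgue_measure]_(t in `[x, y]) v t = B y - B x.
  move=> xy nz; rewrite /Rintegral (@continuous_FTC2 _ v B)//.
  - exact: continuous_subspaceT.
  - split.
    + by move=> t; rewrite in_itv /= => /nz /dB [].
    + by apply: cvg_at_right_filter; exact: cB.
    + by apply: cvg_at_left_filter; exact: cB.
  - move=> t; rewrite in_itv /= => /nz /dB ?; rewrite derive1E.
    exact: derive_val.
have iv := continuous_integrable_itv (- N) N cv.
(* The interval is cut at 0, so that each piece has 0 only as an endpoint, where continuity of [B]
   suffices. *)
have := @Rintegral_itvB _ v (BLeft (- N)) (BRight N) 0 iv.
rewrite !bnd_simp (ltW N0) oppr_le0 (ltW N0) => /(_ isT isT)/eqP.
rewrite subr_eq => /eqP ->.
rewrite Rintegral_itv_obnd_cbnd; last first.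
  apply: integrableS iv => //.
  by apply: subset_itv; rewrite bnd_simp// oppr_le0 ltW.
rewrite !FTC ?oppr_lt0//; first by ring.
  by move=> t /andP[_ t0]; rewrite lt_eqF.
by move=> t /andP[t0 _]; rewrite gt_eqF.
Qed.

(** An infinite integral is read as 0 by [Rintegral], so a nonzero value certifies finiteness; the
    rest is monotone convergence. *)
Lemma cvg_Rintegral_sym (R : realType) (v : R -> R) :
  continuous v -> (forall t, 0 <= v t) ->
  \int[lebesgue_measure]_t v t != 0 ->
  \int[lebesgue_measure]_(t in `[- n%:R, n%:R]) v t @[n --> \oo]
    --> \int[lebesgue_measure]_t v t.
Proof.
move=> cv v0 vn0; rewrite /Rintegral; apply: fine_cvg.
set I := (X in X%:E).
have <- : (\int[lebesgue_measure]_t (v t)%:E)%E = I%:E.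
  rewrite fineK//; move: vn0; rewrite /Rintegral fin_numE.
  by case: (X in fine X) => //=; rewrite eqxx.
rewrite -(@bigcup_itvT R true false).
have mv : measurable_fun setT v by exact: measurable_realfun.continuous_measurable_fun.
apply: ge0_nondecreasing_set_cvg_integral.
- move=> m n mn; apply/subsetPset; apply: subset_itv; rewrite bnd_simp.
    by rewrite lerN2 ler_nat.
  by rewrite ler_nat.
- by move=> n; exact: measurable_itv.
- by move=> n; apply/measurable_realfun.measurable_EFinP; exact: measurable_funTS.
- by move=> n t _; rewrite lee_fin.
Qed.

(** The point 0 is null, and off 0 the measurability of [u] is inherited from the continuous [v]. *)
Lemma Rintegral_eq_off0 (R : realType) (u v : R -> R) :
  continuous v -> (forall t, t != 0 -> u t = v t) ->
  \int[lebesgue_measure]_t u t = \int[lebesgue_measure]_t v t.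
Proof.
move=> cv uv; rewrite /Rintegral; congr fine.
have mD : measurable ([set: R] `\ (0 : R)) by exact: measurableD.
have mv : measurable_fun ([set: R] `\ (0 : R)) v.
  by apply: measurable_funTS; exact: measurable_realfun.continuous_measurable_fun.
have uvD : {in [set: R] `\ (0 : R), v =1 u}.
  by move=> t; rewrite inE => -[_ /eqP t0]; rewrite uv.
rewrite -(@integral_setD1 _ (fun t => (v t)%:E) 0 setT)//; last first.
  exact/measurable_realfun.measurable_EFinP.
rewrite -(@integral_setD1 _ (fun t => (u t)%:E) 0 setT)//; last first.
  by apply/measurable_realfun.measurable_EFinP; exact: eq_measurable_fun uvD mv.
by apply: eq_integral => t /uvD ->.
Qed.

(** * Identification of [f] with its continuous extension *)

Lemma f_of_profile (R : realType) (b c : R) (J : R -> R) (t : R) :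
  J_solution b c J -> t != 0 -> f_of c J t = profile b c J t.
Proof.
by move=> [_ eqJ _ _] t0; rewrite /f_of eqJ// /profile negpart_idE; ring.
Qed.

Lemma derive1_f_of (R : realType) (b c : R) (J : R -> R) (t : R) :
  c != 0 -> J_solution b c J -> t != 0 ->
  derive1 (f_of c J) t = profile_slope b c J t.
Proof.
move=> c0 hJ t0; have hF := is_derive_profile c0 hJ t0.
suff : is_derive t 1 (f_of c J) (profile_slope b c J t).
  by move=> ?; rewrite derive1E; exact: derive_val.
apply: near_eq_is_derive hF.
have : \forall x \near t, x != 0.
  move: t0; rewrite neq_lt => /orP[t0|t0]; near=> x.
    by rewrite lt_eqF//; near: x; exact: lt_nbhsl.
  by rewrite gt_eqF//; near: x; exact: lt_nbhsr.
by apply: filterS => x x0; rewrite (f_of_profile hJ).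
Unshelve. all: by end_near. Qed.

(** At 0 the bounds are limits of those on the right. *)
Lemma profile_itv (R : realType) (b c : R) (J : R -> R) :
  J_solution b c J -> (forall t : R, t != 0 -> 0 <= f_of c J t <= 1) ->
  forall t, 0 <= profile b c J t <= 1.
Proof.
move=> hJ hf t; have [->|t0] := eqVneq t 0; last by rewrite -f_of_profile// hf.
have F0 : profile b c J x @[x --> 0^'+] --> profile b c J 0.
  by apply: cvg_at_right_filter; exact: continuous_profile.
have F01 : \forall x \near 0^'+, 0 <= profile b c J x <= 1.
  near=> x; have x0 : x != 0 by rewrite gt_eqF//; near: x; exact: nbhs_right_gt.
  by rewrite -f_of_profile// hf.
apply/andP; split.
  by apply: cvgr_to_ge F0 _; apply: filterS F01 => x /andP[].
by apply: cvgr_to_le F0 _; apply: filterS F01 => x /andP[].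
Unshelve. all: by end_near. Qed.

(** * Vanishing of the boundary term at both infinities *)

(** The real exponent is traded for a natural number [n >= |s|], since [x ^ s <= x ^ n] for
    [x >= 1]. *)
Lemma powR_poly_growth (R : realType) (w : R -> R) (s l : R) :
  (forall x, 0 <= w x) -> w x / x `^ s @[x --> +oo] --> l ->
  exists n, exists2 M : R, 0 <= M &
    exists N : R, forall x, N < x -> `|w x| <= M * x ^+ n.
Proof.
move=> w0 wl; pose n := Num.bound `|s|.
have sn : s <= n%:R.
  by apply: le_trans (ler_norm _) _; apply/ltW/archi_boundP.
have [N N0 HN] := cvgy_dist wl (ltr01 : 0 < 1 :> R).
exists n, (`|l| + 1); first by rewrite addr_ge0.
exists (N + 1) => x Nx; have x1 : 1 <= x by lra.
have Nx' : N < x by lra.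
have xs0 : 0 < x `^ s by rewrite powR_gt0; lra.
have := HN x Nx'; rewrite ltr_norml => /andP[_ wx].
have wx' : w x / x `^ s <= `|l| + 1 by have := ler_norm l; lra.
rewrite ger0_norm//; move: wx'; rewrite ler_pdivrMr// => /le_trans; apply.
rewrite ler_wpM2l ?addr_ge0// -powR_mulrn; last lra.
exact: ler_powR.
Qed.

(** For [t > 0] the terms in [Theta] vanish, and [J], [J'], [f] form the half-line system with
    [be = b] and [ka = c ^+ 2 / 2]. *)
Lemma boundary_cvgy (R : realType) (a b c s l : R) (J p : R -> R) :
  0 < c -> 0 < b < 1 -> J_solution b c J ->
  (forall t : R, t != 0 -> 0 <= f_of c J t <= 1) ->
  p1_solution a b c J p -> (forall t, 0 <= p t) ->
  p t / t `^ s @[t --> +oo] --> l ->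
  boundary b c J p t @[t --> +oo] --> 0.
Proof.
move=> c_gt0 b01 hJ hf hp p0 pl; have c0 : c != 0 by rewrite gt_eqF.
have [n [M M0 [N HN]]] := powR_poly_growth p0 pl.
have slopeE (x : R) : 0 < x -> profile_slope b c J x =
    (1 - b) * derive1 J x
    + 2 / c * (- b * x + c ^+ 2 / 2 * derive1 J x) * profile b c J x.
  by move=> x0; rewrite /profile_slope /drift negpart_idE Theta_pos//; ring.
have Jy : J t @[t --> +oo] --> 0 by case: hJ.
have hh (x : R) : 0 < x -> is_derive x 1 (derive1 J) (2 / c * profile b c J x).
  move=> x0; have := is_derive_slopeJ c0 hJ (lt0r_neq0 x0).
  by rewrite Theta_pos// subr0.
have hu (x : R) : 0 < x -> is_derive x 1 (profile b c J)
    ((1 - b) * derive1 J x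
    + 2 / c * (- b * x + c ^+ 2 / 2 * derive1 J x) * profile b c J x).
  move=> x0; rewrite -slopeE//.
  exact: is_derive_profile c0 hJ (lt0r_neq0 x0).
have hK (x : R) : 0 < x -> is_derive x 1 (flux b c J p) ((a - b) * p x).
  by move=> x0; exact: is_derive_flux c_gt0 hJ hp (lt0r_neq0 x0).
have hJd (x : R) : 0 < x -> is_derive x 1 J (derive1 J x).
  by move=> _; exact: is_derive_J hJ.
have := flux_cvg0 c_gt0 b01 hJd hh hu (fun x _ => profile_itv hJ hf x) Jy hK M0 HN.
apply: cvg_trans; apply: near_eq_cvg; near=> x.
rewrite /boundary slopeE//; near: x; exact: nbhs_pinfty_gt.
Unshelve. all: by end_near. Qed.

(* The reflection [t |-> - t], [J |-> - J], [f |-> 1 - f] exchanges the two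
   half-lines, with [b] replaced by [b - c] and [c ^+ 2 / 2] by its opposite. *)
Lemma boundary_cvgNy (R : realType) (a b c s l : R) (J p : R -> R) :
  0 < c -> 0 < b - c < 1 -> J_solution b c J ->
  (forall t : R, t != 0 -> 0 <= f_of c J t <= 1) ->
  p1_solution a b c J p -> (forall t, 0 <= p t) ->
  p t / (- t) `^ s @[t --> -oo] --> l ->
  boundary b c J p (- t) @[t --> +oo] --> 0.
Proof.
move=> c_gt0 b01 hJ hf hp p0 pl; have c0 : c != 0 by rewrite gt_eqF.
have ql : p (- t) / t `^ s @[t --> +oo] --> l.
  move/cvgNy_compNP : pl; apply: cvg_trans; apply: near_eq_cvg; near=> x.
  by rewrite /= opprK.
have [n [M M0 [N HN]]] := powR_poly_growth (fun x => p0 (- x)) ql.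
pose u x := 1 - profile b c J (- x).
have slopeE (x : R) : 0 < x -> profile_slope b c J (- x) =
    (1 - (b - c)) * derive1 J (- x)
    + 2 / c * (- (b - c) * x + - (c ^+ 2 / 2) * derive1 J (- x)) * u x.
  move=> x0; rewrite /profile_slope /drift /u negpart_idE Theta_neg ?oppr_lt0//.
  by field.
have Jy : - J (- t) @[t --> +oo] --> - (1 : R).
  by apply: cvgN; apply/cvgNy_compNP; case: hJ.
have nz (x : R) : 0 < x -> - x != 0 by move=> x0; rewrite oppr_eq0 gt_eqF.
have hphi (x : R) : 0 < x ->
    is_derive x 1 (fun y => - J (- y)) (derive1 J (- x)).
  move=> _; have := is_deriveN_pt (is_derive_opp_pt (is_derive_J (- x) hJ)).
  by rewrite opprK.
have hh (x : R) : 0 < x ->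
    is_derive x 1 (fun y => derive1 J (- y)) (2 / c * u x).
  move=> x0; have := is_derive_opp_pt (is_derive_slopeJ c0 hJ (nz x x0)).
  rewrite Theta_neg ?oppr_lt0// /u.
  by rewrite -mulrN opprB.
have hu (x : R) : 0 < x -> is_derive x 1 u
    ((1 - (b - c)) * derive1 J (- x)
    + 2 / c * (- (b - c) * x + - (c ^+ 2 / 2) * derive1 J (- x)) * u x).
  move=> x0.
  have := is_deriveN_pt (is_derive_opp_pt (is_derive_profile c0 hJ (nz x x0))).
  move=> /(is_deriveD_pt (is_derive_cst_pt 1 x)).
  by rewrite add0r opprK slopeE.
have hK (x : R) : 0 < x ->
    is_derive x 1 (fun y => - flux b c J p (- y)) ((a - b) * p (- x)).
  move=> x0.
  have := is_deriveN_pt (is_derive_opp_pt (is_derive_flux c_gt0 hJ hp (nz x x0))).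
  by rewrite opprK.
have u01 (x : R) : 0 < x -> 0 <= u x <= 1.
  by move=> _; have := profile_itv hJ hf (- x); rewrite /u; lra.
have := flux_cvg0 c_gt0 b01 hphi hh hu u01 Jy hK M0 HN.
(* Under the reflection [1 - 2 f] and the flux term both change sign, so the limit obtained is that
   of the opposite of [boundary]. *)
move=> /cvgN; rewrite oppr0; apply: cvg_trans; apply: near_eq_cvg; near=> x.
rewrite /= !fctE /= -slopeE; last by near: x; exact: nbhs_pinfty_gt.
by rewrite /boundary /u; ring.
Unshelve. all: by end_near. Qed.

(** * The truncated balance and its limit *)

Theorem theorem13 (R : realType) (a b c : R) (J p1 : R -> R)
    (hc : 0 < c < 1)
    (hb : b = (1 + c) / 2)
    (hJ : J_solution b c J)
    (hf : forall t : R, t != 0 -> 0 <= f_of c J t <= 1)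
    (hp1 : p1_solution a b c J p1)
    (hp1_ge0 : forall t, 0 <= p1 t)
    (htheta : 0 < theta_exp a b c)
    (halpha : 0 < alpha_exp a b)
    (hp1_ninfty : exists2 A : R, 0 < A &
       p1 t / (- t) `^ theta_exp a b c @[t --> -oo] --> A)
    (hp1_pinfty : exists2 B : R, 0 < B &
       p1 t / t `^ (- alpha_exp a b) @[t --> +oo] --> B)
    (hms : marginally_stable p1 (f_of c J)) :
  a + c / 2 = 1 / 2 /\ a + b = 1.
Proof.
have /andP[c_gt0 c_lt1] := hc; have c0 : c != 0 by rewrite gt_eqF.
set D1 := fun t => p1 t * profile b c J t ^+ 2 * (1 - profile b c J t).
set D2 := fun t => p1 t * profile_slope b c J t ^+ 2.
set D3 := fun t => p1 t * (profile b c J t * (1 - profile b c J t)).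
have cp := continuous_p1 hp1; have cF := continuous_profile hJ.
have cF1 := continuous_profile_slope hJ.
have c1F t : (1 - profile b c J x) @[x --> t] --> 1 - profile b c J t.
  by apply: cvgB; [exact: cvg_cst|exact: cF].
have cD1 : continuous D1.
  move=> t; apply: cvgM; last exact: c1F.
  by apply: cvgM; [exact: cp|exact: (cvgM (cF t) (cF t))].
have cD2 : continuous D2.
  by move=> t; apply: cvgM; [exact: cp|exact: (cvgM (cF1 t) (cF1 t))].
have cD3 : continuous D3.
  by move=> t; apply: cvgM; [exact: cp|apply: cvgM; [exact: cF|exact: c1F]].
have F01 := profile_itv hJ hf.
have D1_ge0 t : 0 <= D1 t.
  have /andP[F0 F1] := F01 t.
  by rewrite /D1 !mulr_ge0 ?exprn_ge0 ?subr_ge0.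
have D2_ge0 t : 0 <= D2 t by rewrite mulr_ge0 ?sqr_ge0.
have D13 t : D1 t <= D3 t.
  have := F01 t; rewrite /D1 /D3 -mulrA => /andP[F0 F1].
  by rewrite ler_wpM2l// ler_wpM2r ?subr_ge0// expr2 ler_piMl.
move: hms; rewrite /marginally_stable.
rewrite (@Rintegral_eq_off0 _ _ D1)//; last first.
  by move=> t t0; rewrite (f_of_profile hJ).
rewrite (@Rintegral_eq_off0 _ (fun t => p1 t * derive1 (f_of c J) t ^+ 2) D2)//; last first.
  by move=> t t0; rewrite (derive1_f_of c0 hJ).
set I1 := Rintegral _ _ _; set I2 := Rintegral _ _ _ => I12.
(* A zero denominator would make the quotient 0 instead of 1/2. Nonvanishing of [I2], then of [I1],
   gives convergence of the truncated integrals. *)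
have I2n0 : I2 != 0.
  by apply/eqP => I20; move: I12; rewrite I20 invr0 mulr0; lra.
have I21 : I2 = 2 * I1.
  have -> : I1 = I1 / I2 * I2 by rewrite divfK.
  by rewrite -I12; field.
have I1n0 : I1 != 0 by apply: contraNneq I2n0 => I10; rewrite I21 I10 mulr0.
have I1_gt0 : 0 < I1 by rewrite lt_neqAle eq_sym I1n0 Rintegral_ge0.
have cvgI1 := cvg_Rintegral_sym cD1 D1_ge0 I1n0.
have cvgI2 := cvg_Rintegral_sym cD2 D2_ge0 I2n0.
have [A _ pA] := hp1_ninfty; have [B _ pB] := hp1_pinfty.
have b01 : 0 < b < 1 by lra.
have bc01 : 0 < b - c < 1 by lra.
have By := boundary_cvgy c_gt0 b01 hJ hf hp1 hp1_ge0 pB.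
have BNy := boundary_cvgNy c_gt0 bc01 hJ hf hp1 hp1_ge0 pA.
set Bd := boundary b c J p1 in By BNy.
have cvgBd : (Bd n%:R - Bd (- n%:R)) @[n --> \oo] --> (0 - 0 : R).
  by apply: cvgB; [exact: cvg_comp cvgr_idn By|exact: cvg_comp cvgr_idn BNy].
pose lam := a - b + c.
have cD : continuous (fun t => c * (2 * D1 t - D2 t) - lam * D3 t).
  move=> t; apply: cvgB; apply: cvgMr; last exact: cD3.
  by apply: cvgB; [apply: cvgMr; exact: cD1|exact: cD2].
(* The derivative of the boundary term, integrated over [[-n, n]]; [n > 0] puts 0 in the
   interior. *)
have balance (n : nat) : (0 < n)%N ->
    Bd n%:R - Bd (- n%:R) =
    c * (2 * \int[lebesgue_measure]_(t in `[- n%:R, n%:R]) D1 t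
         - \int[lebesgue_measure]_(t in `[- n%:R, n%:R]) D2 t)
    - lam * \int[lebesgue_measure]_(t in `[- n%:R, n%:R]) D3 t.
  move=> n0; have iD v : continuous v -> _ :=
    @continuous_integrable_itv R v (- n%:R) n%:R.
  have N0 : 0 < n%:R :> R by rewrite ltr0n.
  have dB (t : R) (t0 : t != 0) := is_derive_boundary c_gt0 hb hJ hp1 t0.
  rewrite -(FTC2_off0 N0 (continuous_boundary hJ hp1) cD dB).
  rewrite RintegralB//=; last 2 first.
  - apply: iD => t; apply: cvgMr.
    by apply: cvgB; [apply: cvgMr; exact: cD1|exact: cD2].
  - by apply: iD => t; apply: cvgMr; exact: cD3.
  rewrite !RintegralZl//=; last 2 first.
  - exact: iD.
  - by apply: iD => t; apply: cvgB; [apply: cvgMr; exact: cD1|exact: cD2].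
  rewrite RintegralB//=; last 2 first.
  - by apply: iD => t; apply: cvgMr; exact: cD1.
  - exact: iD.
  by rewrite RintegralZl//; exact: iD.
(* By [balance] the first absolute value is [|lam|] times the truncated integral of [D3], which is
   only known to dominate that of [D1]; the latter converges. *)
have lim0 : `|c * (2 * \int[lebesgue_measure]_(t in `[- n%:R, n%:R]) D1 t
         - \int[lebesgue_measure]_(t in `[- n%:R, n%:R]) D2 t)
       - (Bd n%:R - Bd (- n%:R))|
    - `|lam| * \int[lebesgue_measure]_(t in `[- n%:R, n%:R]) D1 t @[n --> \oo]
    --> `|c * (2 * I1 - I2) - (0 - 0)| - `|lam| * I1.
  apply: cvgB; last by apply: cvgMr.
  apply: cvg_norm; apply: cvgB => //.
  by apply: cvgMr; apply: cvgB => //; apply: cvgMr.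
have lamI1 : 0 <= `|c * (2 * I1 - I2) - (0 - 0)| - `|lam| * I1.
  apply: cvgr_to_ge lim0 _; near=> n.
  have n0 : (0 < n)%N by near: n; exists 1%N.
  rewrite (balance n n0) subKr normrM subr_ge0 ler_wpM2l//.
  rewrite [leRHS]ger0_norm; last first.
    by apply: Rintegral_ge0 => t _; exact: le_trans (D13 t).
  by apply: le_Rintegral => //; exact: continuous_integrable_itv.
(* With [I2 = 2 I1] the inequality reads [0 <= - |lam| I1], and [I1 > 0]. *)
have lam0 : lam = 0.
  move: lamI1; rewrite I21 !subrr mulr0 subrr normr0 sub0r oppr_ge0.
  by rewrite pmulr_lle0// normr_le0 => /eqP.
move: lam0; rewrite /lam hb; lra.
Unshelve. all: by end_near. Qed.
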